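(* For every integer $n \ge 1$, \[\sum_{d\mid n}\left[\varphi\!\left(\frac{n}{d}\right)\right]^2\left(\frac{n}{d}\right)^{d-1}(d-1)! \equiv 0 \pmod n,\] where the sum runs over the positive divisors $d$ of $n$ and $\varphi$ is Euler's totient function. *)

(* Defs.v *)
(* MathComp *)
From mathcomp Require Export all_boot.

(* Main.v *)
Require Import Defs.
From mathcomp Require Import all_boot.
From mathcomp Require Import ssralg zmodp fingroup perm action gproduct cyclic.

(** Let the square of a group of order [n] act on its permutations by
    translations on both sides. A permutation fixed by [(a, b)] intertwines
    the translations by [a] and by [b]; there is none unless [a] and [b] have
    the same order [m], and then there are [m ^ (n / m) * (n / m)!] of them.
    For a cyclic group, [n] times the sum of the theorem is thus the total
    number of fixed points, which is [n ^ 2] times the number of orbits. *)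

(** The left cosets of [<[a]>] partition the group into [d] rows of length [m.+1]. Choosing a
    representative [r i] in each row writes every element uniquely as [r i * a ^+ j]. Addition in
    ['I_m.+1] is modular, which matches the order of [a]. *)
Lemma cycle_coordinates {gT : finGroupType} {a : gT} {d m : nat} :
  #[a]%g = m.+1 -> #|gT| = d * m.+1 ->
  exists2 phi : 'I_d * 'I_m.+1 -> gT, bijective phi &
    forall i (j c : 'I_m.+1), phi (i, (j + c)%R) = (phi (i, j) * a ^+ c)%g.
Proof.
move=> oa cardG; set cosets := lcosets <[a]>%g [set: gT].
have cardC : #|cosets| = d.
  by rewrite card_lcosets -divgS ?subsetT // cardsT cardG -orderE oa mulnK.
pose A (i : 'I_d) := enum_val (cast_ord (esym cardC) i).
pose r i := repr (A i).
have rA i : A i = (r i *: <[a]>)%g.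
  have /lcosetsP[x _ Ax] := enum_valP (cast_ord (esym cardC) i).
  have rx : r i \in (x *: <[a]>)%g.
    by rewrite /r /A Ax (mem_repr x) // lcoset_refl.
  by rewrite [LHS]Ax (lcoset_eqP rx).
pose phi (p : 'I_d * 'I_m.+1) := (r p.1 * a ^+ p.2)%g.
exists phi; last first.
  by move=> i j c; rewrite /phi /= -mulgA -expgD -[RHS]/(r i * a ^+ (j + c))%g
    -(expg_mod_order a (j + c)) oa.
apply: inj_card_bij; last by rewrite card_prod !card_ord cardG.
move=> [i j] [i' j']; rewrite /phi /= => eq_phi.
have eqA : A i = A i'.
  rewrite !rA; apply/lcoset_eqP.
  have <- : (r i' * a ^+ j' * a ^- j)%g = r i by rewrite -eq_phi mulgK.
  by rewrite -mulgA mem_lcoset mulKg groupM ?groupV ?mem_cycle.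
have eqi : i = i' by move/enum_val_inj/cast_ord_inj: eqA.
move: eq_phi; rewrite -eqi => /mulgI/eqP; rewrite eq_expg_mod_order oa.
by rewrite !modn_small ?ltn_ord // => /eqP/val_inj ->.
Qed.

(** Such a permutation is determined by its values at the points [(i, 0)]: it permutes the [d] rows
    by some [p] and rotates row [i] by some [f i], and any pair [(p, f)] arises. *)
Lemma card_shift_equivariant_perm (d m : nat) :
  #|[set s : {perm 'I_d * 'I_m.+1} |
      [forall i, forall j : 'I_m.+1, forall c : 'I_m.+1,
        s (i, (j + c)%R) == ((s (i, j)).1, ((s (i, j)).2 + c)%R)]]|
  = m.+1 ^ d * d`!.
Proof.
set S := [set s | _].
pose F (p : {perm 'I_d} * {ffun 'I_d -> 'I_m.+1}) (x : 'I_d * 'I_m.+1) :=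
  (p.1 x.1, (p.2 x.1 + x.2)%R).
have F_inj p : injective (F p).
  move=> [i j] [i' j'] eqF; have /perm_inj /= eqi := congr1 fst eqF.
  by move: (congr1 snd eqF); rewrite /F /= -eqi => /GRing.addrI ->.
pose G p := perm (F_inj p).
have G_inj : injective G.
  move=> [p f] [q g] /permP eqG; have {}eqG i : p i = q i /\ f i = g i.
    move: (eqG (i, 0%R)); rewrite !permE /F /= !GRing.addr0 => eq_pf.
    by split; [exact: (congr1 fst eq_pf) | exact: (congr1 snd eq_pf)].
  congr pair; first by apply/permP=> i; case: (eqG i).
  by apply/ffunP=> i; case: (eqG i).
have -> : S = [set G p | p in setT].
  apply/setP=> s; rewrite inE; apply/idP/imsetP.
    move=> /forallP sS.
    have {}sS i (j c : 'I_m.+1) :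
        s (i, (j + c)%R) = ((s (i, j)).1, ((s (i, j)).2 + c)%R).
      by have /forallP/(_ j)/forallP/(_ c)/eqP := sS i.
    have s0 i j : s (i, j) = ((s (i, 0%R)).1, ((s (i, 0%R)).2 + j)%R).
      by rewrite -sS GRing.add0r.
    have p_inj : injective (fun i => (s (i, 0%R)).1).
      move=> i i' eq1.
      (* If rows [i] and [i'] went to the same row, rotating by this difference would give [(i', j)]
         and [(i, 0)] the same image. *)
      pose j := ((s (i, 0%R)).2 - (s (i', 0%R)).2)%R.
      have : s (i', j) = s (i, 0%R).
        by rewrite s0 -eq1 GRing.addrC GRing.subrK -surjective_pairing.
      by move/perm_inj => -[].
    exists (perm p_inj, [ffun i => (s (i, 0%R)).2]); rewrite ?inE //.
    by apply/permP=> -[i j]; rewrite permE /F /= permE ffunE -s0.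
  case=> p _ ->; apply/forallP=> i; apply/forallP=> j; apply/forallP=> c.
  by rewrite !permE /F /= GRing.addrA.
rewrite card_imset // cardsT card_prod card_ffun !card_ord mulnC.
congr (_ * _).
have -> : #|{: {perm 'I_d}}| = #|perm_on [set: 'I_d]|.
  by apply: eq_card => s; rewrite !inE; apply/esym/subsetP=> i; rewrite inE.
by rewrite card_perm cardsT card_ord.
Qed.

Definition intertwiners {gT : finGroupType} (a b : gT) : {set {perm gT}} :=
  [set s : {perm gT} | [forall x, s (x * a)%g == (s x * b)%g]].

Lemma intertwinersP {gT : finGroupType} (a b : gT) (s : {perm gT}) :
  reflect (forall x k, s (x * a ^+ k)%g = (s x * b ^+ k)%g)
          (s \in intertwiners a b).
Proof.
rewrite inE; apply: (iffP forallP) => [sab x k | sab x].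
  elim: k => [|k IH]; first by rewrite !mulg1.
  by rewrite !expgSr !mulgA (eqP (sab _)) IH.
by move: (sab x 1); rewrite !expg1 => ->.
Qed.

(** In coordinates [f] adapted to [a] on the source and [g] adapted to [b] on the target, both
    translations become the same shift, so intertwiners correspond to shift-equivariant
    permutations. *)
Lemma card_intertwiners_eq_order {gT : finGroupType} {a b : gT} {d m : nat} :
  #[a]%g = m -> #[b]%g = m -> #|gT| = d * m ->
  #|intertwiners a b| = m ^ d * d`!.
Proof.
case: m => [/eqP|m oa ob cardG]; first by rewrite eqn0Ngt order_gt0.
have [f [f' fK f'K] fD] := cycle_coordinates oa cardG.
have [g [g' gK g'K] gD] := cycle_coordinates ob cardG.
have to_inj (s : {perm 'I_d * 'I_m.+1}) : injective (fun x => g (s (f' x))).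
  by move=> x y /(can_inj gK)/perm_inj/(can_inj f'K).
have of_inj (s : {perm gT}) : injective (fun x => g' (s (f x))).
  by move=> x y /(can_inj g'K)/perm_inj/(can_inj fK).
rewrite -card_shift_equivariant_perm.
rewrite -(card_imset _ (f := fun s => perm (to_inj s))); last first.
  move=> s t /permP eq_st; apply/permP=> x.
  by move: (eq_st (f x)); rewrite !permE !fK => /(can_inj gK).
congr #|pred_of_set _|; apply/setP=> s; apply/intertwinersP/imsetP.
  move=> sab; exists (perm (of_inj s)); last first.
    by apply/permP=> x; rewrite !permE g'K f'K.
  rewrite inE; apply/forallP=> i; apply/forallP=> j; apply/forallP=> c.
  rewrite !permE fD sab; apply/eqP/(can_inj gK); rewrite g'K gD.
  by rewrite -surjective_pairing g'K.
case=> t; rewrite inE => /forallP tS -> {s} x k.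
(* The coordinates only know shifts by elements of ['I_m.+1], so the exponent is first reduced
   modulo the common order. *)
pose c : 'I_m.+1 := inZp k.
have -> : (a ^+ k = a ^+ c)%g by rewrite /= -oa expg_mod_order.
have -> : (b ^+ k = b ^+ c)%g by rewrite /= -ob expg_mod_order.
rewrite !permE -[in LHS](f'K x); case: (f' x) => i j.
have /forallP/(_ j)/forallP/(_ c)/eqP eqt := tS i.
by rewrite -fD fK eqt gD -surjective_pairing.
Qed.

(** An intertwiner sends [a ^+ k] to [s 1 * b ^+ k], so [a ^+ k] and [b ^+ k] are trivial for the
    same [k], and each order divides the other. *)
Lemma card_intertwiners_neq_order {gT : finGroupType} {a b : gT} :
  #[a]%g != #[b]%g -> #|intertwiners a b| = 0.
Proof.
move=> neq_ab; apply: eq_card0 => s; apply/negP=> /intertwinersP sab.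
case/negP: neq_ab; rewrite eqn_dvd !order_dvdn; apply/andP; split.
  apply/eqP/(@mulgI _ 1%g)/(@perm_inj _ s); rewrite sab expg_order !mulg1 //.
by apply/eqP/(@mulgI _ (s 1%g)); rewrite -sab expg_order !mulg1.
Qed.

(** A cyclic group has exactly one subgroup of order [m], here [<[y]>], and the elements of order
    [m] are precisely its generators. *)
Lemma card_order_cyclic {gT : finGroupType} {m : nat} :
  cyclic [set: gT] -> m %| #|gT| -> #|[set a : gT | #[a]%g == m]| = totient m.
Proof.
case/cyclicP=> x genx m_dv.
have ox : #[x]%g = #|gT| by rewrite orderE -genx cardsT.
have m_gt0 : 0 < m by apply: dvdn_gt0 m_dv; rewrite -ox order_gt0.
set y := (x ^+ (#[x] %/ m))%g.
have sub1 : [set H : {group gT} | H \subset <[x]>%g & #|H| == m] = [set <[y]>%G].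
  by apply: cycle_sub_group; rewrite ox.
have oy : #[y]%g = m.
  have : <[y]>%G \in [set <[y]>%G] by rewrite inE.
  by rewrite -sub1 inE => /andP[_ /eqP].
rewrite -{2}oy totient_gen; apply: eq_card => a; rewrite !inE /generator.
apply/eqP/eqP=> [oa | eq_ya]; last by rewrite orderE -eq_ya.
have : <[a]>%G \in [set <[y]>%G] by rewrite -sub1 inE -genx subsetT -orderE oa /=.
by rewrite inE => /eqP/(congr1 val) /= ->.
Qed.

Section Burnside.

Variable gT : finGroupType.

Definition right_translation (a : gT) : {perm gT} := perm (@mulIg gT a).

Lemma right_translationM (a b : gT) :
  right_translation (a * b)%g = (right_translation a * right_translation b)%g.
Proof. by apply/permP=> x; rewrite permM !permE mulgA. Qed.

Lemma right_translation1 : right_translation 1%g = 1%g.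
Proof. by apply/permP=> x; rewrite !permE mulg1. Qed.

(** Products of permutations compose from left to right, so this maps [x] to [s (x * p.1^-1) * p.2].
    The inverse on the first factor makes the fixed points intertwine [p.1] with [p.2]. *)
Definition translate (s : {perm gT}) (p : gT * gT) : {perm gT} :=
  ((right_translation p.1)^-1 * s * right_translation p.2)%g.

Lemma translate1 : translate^~ 1%g =1 id.
Proof. by move=> s; rewrite /translate !right_translation1 invg1 mul1g mulg1. Qed.

Lemma translateM (s : {perm gT}) : act_morph translate s.
Proof. by move=> p q; rewrite /translate !right_translationM invMg !mulgA. Qed.

Canonical translate_action := TotalAction translate1 translateM.

Lemma translate_fix (p : gT * gT) :
  'Fix_([set: {perm gT}] | translate_action)[p]%g = intertwiners p.1 p.2.
Proof.
apply/setP=> s; rewrite in_setI in_setT /=; apply/afix1P/idP => /=; rewrite /translate.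
  move=> fix_s; rewrite inE; apply/forallP=> x; apply/eqP.
  (* Evaluating at [x * p.1] cancels the inverse translation. *)
  move/permP: fix_s => /(_ (x * p.1)%g).
  by rewrite !permM -{1}[(x * p.1)%g](permE (@mulIg gT p.1)) permK !permE.
move/intertwinersP=> sp.
rewrite -mulgA; apply: (canLR (mulKg _)); apply/permP=> x.
by rewrite !permM !permE -[p.1]expg1 sp.
Qed.

Lemma dvdn_sum_intertwiners :
  #|gT| ^ 2 %| \sum_(p : gT * gT) #|intertwiners p.1 p.2|.
Proof.
have acts : [acts [set: gT * gT], on [set: {perm gT}] | translate_action]%g.
  by apply/actsP=> p _ s; rewrite !inE.
have -> : \sum_(p : gT * gT) #|intertwiners p.1 p.2| =
    \sum_(p in [set: gT * gT]) #|'Fix_([set: {perm gT}] | translate_action)[p]%g|.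
  by apply: eq_big => [p | p _]; rewrite ?inE ?translate_fix.
by rewrite (Frobenius_Cauchy acts) cardsT card_prod mulnn dvdn_mull.
Qed.

End Burnside.

(** Only pairs of equal order contribute. For each order [m] there are [totient m] choices of [a]
    and as many of [b], whence the square. *)
Lemma sum_intertwiners_cyclic {gT : finGroupType} :
  cyclic [set: gT] ->
  \sum_(p : gT * gT) #|intertwiners p.1 p.2| =
  \sum_(m <- divisors #|gT|)
    totient m ^ 2 * (m ^ (#|gT| %/ m) * (#|gT| %/ m)`!).
Proof.
move=> cycG; have n_gt0 : 0 < #|gT| by apply/card_gt0P; exists 1%g.
rewrite -(pair_bigA _ (fun a b => #|intertwiners a b|)) /=.
have odv (a : gT) : #[a]%g %| #|gT| by rewrite -cardsT order_dvdG ?inE.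
have inner (a : gT) : \sum_(b : gT) #|intertwiners a b| =
    totient #[a]%g * (#[a]%g ^ (#|gT| %/ #[a]%g) * (#|gT| %/ #[a]%g)`!).
  rewrite (bigID (fun b => #[b]%g == #[a]%g)) /= [X in _ + X]big1 ?addn0; last first.
    by move=> b; rewrite eq_sym; apply: card_intertwiners_neq_order.
  rewrite -(card_order_cyclic cycG (odv a)) -sum_nat_const.
  apply: eq_big => [b | b /eqP ob]; first by rewrite inE.
  by apply: card_intertwiners_eq_order; rewrite // divnK.
rewrite (eq_bigr _ (fun a _ => inner a)).
pose F m := totient m * (m ^ (#|gT| %/ m) * (#|gT| %/ m)`!).
(* The inner sum has the single term [m = #[a]]; it is inserted so that exchanging the sums groups
   the elements by order. *)
transitivity (\sum_(a : gT) \sum_(m <- divisors #|gT| | #[a]%g == m) F m).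
  apply: eq_bigr => a _; rewrite (eq_bigl _ _ (fun m => eq_sym _ m)).
  by rewrite -big_filter filter_pred1_uniq ?divisors_uniq ?big_seq1 // -dvdn_divisors.
rewrite (exchange_big_dep predT) //= [LHS]big_seq [RHS]big_seq.
apply: eq_bigr => m; rewrite -dvdn_divisors // => m_dv.
by rewrite sum_nat_cond_const (card_order_cyclic cycG m_dv) /F mulnA mulnn.
Qed.

Theorem theorem2 (n : nat) (n_ge1 : 1 <= n) :
  \sum_(d <- divisors n) (totient (n %/ d) ^ 2 * (n %/ d) ^ (d - 1) * (d - 1)`!)
    = 0 %[mod n].
Proof.
case: n n_ge1 => // n _; set S := \sum_(d <- _) _.
(* The square of [n.+1] divides the left side, so cancelling one factor leaves [n.+1] dividing
   [S]. *)
suff eqS : \sum_(p : 'I_n.+1 * 'I_n.+1) #|intertwiners p.1 p.2| = n.+1 * S.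
  have := dvdn_sum_intertwiners 'I_n.+1.
  by rewrite eqS card_ord expnS expn1 dvdn_pmul2l // => /eqP; rewrite mod0n.
have cycZ : cyclic [set: 'I_n.+1] by apply/cyclicP; exists Zp1; apply: Zp_cycle.
rewrite (sum_intertwiners_cyclic cycZ) card_ord.
(* The fixed-point count is indexed by the order, the target sum by the codivisor; taking codivisors
   is an involution on the divisors. *)
have codivisors : perm_eq (divisors n.+1) [seq n.+1 %/ d | d <- divisors n.+1].
  apply: uniq_perm; rewrite ?divisors_uniq //.
    rewrite map_inj_in_uniq ?divisors_uniq // => d e.
    rewrite -!dvdn_divisors // => d_dv e_dv eq_de.
    by have := congr1 (divn n.+1) eq_de; rewrite !divnA // !mulKn.
  move=> m; rewrite -dvdn_divisors //; apply/idP/mapP => [m_dv | [d d_dv ->]].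
    exists (n.+1 %/ m); first by rewrite -dvdn_divisors // dvdn_div.
    by rewrite divnA // mulKn.
  by rewrite dvdn_div // dvdn_divisors.
rewrite (perm_big _ codivisors) big_map big_distrr /= [LHS]big_seq [RHS]big_seq.
apply: eq_bigr => d; rewrite -dvdn_divisors // => d_dv.
have d_gt0 : 0 < d by apply: dvdn_gt0 d_dv.
have -> : n.+1 %/ (n.+1 %/ d) = d by rewrite divnA // mulKn.
set q := n.+1 %/ d; have -> : n.+1 = q * d by rewrite divnK.
case: d d_gt0 {d_dv} @q => // d _ q.
(* The divisor is now [d.+1]. The factor [q * d.+1], equal to the group order, splits off because
   q^(d+1) (d+1)! = q (d+1) q^d d!. *)
rewrite subn1 /= factS [q ^ d.+1]expnS; move: (totient q ^ 2) => t; rewrite -!mulnA mulnCA; congr (_ * _).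
by rewrite [q ^ d * _]mulnCA mulnCA.
Qed.
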